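(* Let the optimal solution of Problem (A) be $(u_0^\star, \alpha^\star) \in \mathbb{R}^N \times \mathbb{R}^N$, and let the optimal solution of Problem (B) be $\mathsf{u}^\star \in \mathcal{L}^2(\Omega,\mathbb{R}^N)$, where Problems (A) and (B) are the optimization problems defined in the context. Then $$\mathsf{u}^\star = u_0^\star - \alpha^\star\, \mathbf{1}_N^\top S_d\, \xi$$ holds, such that $\mathsf{u}^\star \sim \mathsf{N}\big(u_0^\star,\ (\alpha^\star \mathbf{1}_N^\top S_d)(\alpha^\star \mathbf{1}_N^\top S_d)^\top\big)$.
   Context: Notation: $N, N_l \in \mathbb{N}$ are the numbers of buses and lines, $\mathcal{N} = \{1,\dots,N\}$, $\mathcal{N}_l = \{1,\dots,N_l\}$, and $\mathbf{1}_N \in \mathbb{R}^N$ is the vector of ones. $\mathcal{L}^2(\Omega,\mathbb{R}^N)$ is the space of $\mathbb{R}^N$-valued random vectors with entries of finite variance. $\mathsf{N}(\mu,\Sigma)$ is the (possibly degenerate) multivariate Gaussian distribution with mean $\mu$ and positive semidefinite covariance $\Sigma$. Data: $h \in \mathbb{R}^N$ (linear cost $J(u) = h^\top u$); bounds $\underline{u},\overline{u} \in \mathbb{R}^N$ and $\underline{p}_l,\overline{p}_l \in \mathbb{R}^{N_l}$; a matrix $\phi \in \mathbb{R}^{N_l \times N}$ (power transfer distribution factors); constants $\beta_u, \beta_l$ (determined by user-defined security levels). The uncertain power is $\mathsf{d} = d_0 + S_d \xi$ with $d_0 \in \mathbb{R}^N$, nonsingular $S_d \in \mathbb{R}^{N\times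 N}$, and $\xi \sim \mathsf{N}(0, I_N)$ (the stochastic germ). Setting (standing throughout): the feedback policy $\mathsf{u}$ has the form $$\mathsf{u} = u_0 - \alpha\, \mathbf{1}_N^\top S_d\, \xi, \qquad \mathbf{1}_N^\top(u_0 + d_0) = 0, \qquad 1 - \mathbf{1}_N^\top \alpha = 0, \qquad u_0, \alpha \in \mathbb{R}^N .$$ The line flow is $\mathsf{p}_l = \phi(\mathsf{u} + \mathsf{d})$, with $j$-th entry $\mathsf{p}_{l,j}$. The inequality constraints (reformulated individual chance constraints) are, for all $i \in \mathcal{N}$ and $j \in \mathcal{N}_l$ and for both signs, $$\underline{u}_i \le \operatorname{E}[\mathsf{u}_i] \pm \beta_u \sqrt{\operatorname{Var}[\mathsf{u}_i]} \le \overline{u}_i, \qquad \underline{p}_{l,j} \le \operatorname{E}[\mathsf{p}_{l,j}] \pm \beta_l \sqrt{\operatorname{Var}[\mathsf{p}_{l,j}]} \le \overline{p}_{l,j}. \qquad (\ast)$$ Problem (A): minimize $h^\top u_0$ over $u_0, \alpha \in \mathbb{R}^N$ subject to $\mathbf{1}_N^\top (u_0 + d_0) = 0$, $1 - \mathbf{1}_N^\top \alpha = 0$, and $(\ast)$, where $\mathsf{u} = u_0 - \alpha \mathbf{1}_N^\top S_d \xi$. Problem (B): minimize $\operatorname{E}[h^\top \mathsf{u}]$ over $\mathsf{u} \in \mathcal{L}^2(\Omega,\mathbb{R}^N)$, considered under the Setting above (so $\mathsf{u}$ is a policy of the form given there), subject to $\mathbf{1}_N^\top(\mathsf{u} + \mathsf{d})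 = 0$ (as random variables) and $(\ast)$. ''The optimal solution'' presupposes that the optimal solution exists and is unique. *)

(* Defs.v *)
From HB Require Import structures.
From mathcomp Require Export all_boot all_order all_algebra.
From mathcomp Require Export all_classical all_reals all_analysis.

Set Implicit Arguments.
Unset Strict Implicit.
Unset Printing Implicit Defensive.
Import Order.TTheory GRing.Theory Num.Theory.
Import numFieldNormedType.Exports.

Local Open Scope classical_set_scope.
Local Open Scope ring_scope.

Section Optimization.
Context {V : Type} {disp : Order.disp_t} {C : porderType disp}.

Definition is_minimizer (feasible : V -> Prop) (cost : V -> C) (x : V) : Prop :=
  feasible x /\ forall y, feasible y -> (cost x <= cost y)%O.

(* Uniqueness is relative to the equality [eqV] of the decision space, so that
   elements of L^2 can be compared almost surely. *)
Definition is_unique_minimizer (eqV : V -> V -> Prop)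
    (feasible : V -> Prop) (cost : V -> C) (x : V) : Prop :=
  is_minimizer feasible cost x /\
  forall y, is_minimizer feasible cost y -> eqV y x.

End Optimization.

Section RandomVectors.
Context {d : measure_display} {T : measurableType d} {R : realType}
  (P : probability T R).

(* Univariate Gaussian law with mean m and variance v.  [normal_prob] takes the
   standard deviation and is not a point mass when that is 0. *)
Definition gaussian_prob (m v : R) (A : set R) : \bar R :=
  if v == 0 then \d_m A else normal_prob m (Num.sqrt v) A.

(* X ~ N(mu, Sigma), with Sigma symmetric positive semidefinite and possibly
   singular: the law of X is determined by its one-dimensional projections, and
   t^T X has law N(t^T mu, t^T Sigma t) for every t. *)
Definition gaussian_vector {n : nat} (X : T -> 'cV[R]_n)
    (mu : 'cV[R]_n) (Sigma : 'M[R]_n) : Prop :=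
  [/\ Sigma^T = Sigma,
      forall t : 'cV[R]_n, 0 <= (t^T *m Sigma *m t) 0 0,
      forall i, measurable_fun [set: T] (fun w => X w i 0) &
      forall (t : 'cV[R]_n) (A : set R), measurable A ->
        P [set w | A ((t^T *m X w) 0 0)] =
        gaussian_prob ((t^T *m mu) 0 0) ((t^T *m Sigma *m t) 0 0) A].

(* Representatives of elements of L^2(Omega, R^n); equality in that space is
   [as_eq]. *)
Definition L2_vector {n : nat} (X : T -> 'cV[R]_n) : Prop :=
  forall i, (fun w => X w i 0) \in Lfun P 2%:E.

Definition as_eq {n : nat} (X Y : T -> 'cV[R]_n) : Prop :=
  {ae P, forall w, X w = Y w}.

Definition mean (X : T -> R) : R := fine 'E_P[X].
Definition stddev (X : T -> R) : R := Num.sqrt (fine 'V_P[X]).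

Definition chance_bounds (beta lo hi : R) (X : T -> R) : Prop :=
  (lo <= mean X + beta * stddev X <= hi) /\
  (lo <= mean X - beta * stddev X <= hi).

End RandomVectors.

Record opf_data (R : realType) (N Nl : nat) := OpfData {
  cost_coef : 'cV[R]_N;
  u_min : 'cV[R]_N;
  u_max : 'cV[R]_N;
  pl_min : 'cV[R]_Nl;
  pl_max : 'cV[R]_Nl;
  ptdf : 'M[R]_(Nl, N);
  beta_u : R;
  beta_l : R;
  d_mean : 'cV[R]_N;
  d_factor : 'M[R]_N }.

Definition ones {R : realType} (N : nat) : 'cV[R]_N := const_mx 1.

Section OptimalPowerFlow.
Context {d : measure_display} {T : measurableType d} {R : realType}
  (P : probability T R) {N Nl : nat} (D : opf_data R N Nl)
  (xi : T -> 'cV[R]_N).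

Definition uncertain_power (w : T) : 'cV[R]_N :=
  d_mean D + d_factor D *m xi w.

Definition gain (alpha : 'cV[R]_N) : 'M[R]_N :=
  alpha *m ((ones N)^T *m d_factor D).

Definition policy (u0 alpha : 'cV[R]_N) (w : T) : 'cV[R]_N :=
  u0 - gain alpha *m xi w.

Definition balanced (u0 alpha : 'cV[R]_N) : Prop :=
  (ones N)^T *m (u0 + d_mean D) = 0 /\ 1%:M - (ones N)^T *m alpha = 0.

Definition line_flow (u : T -> 'cV[R]_N) (w : T) : 'cV[R]_Nl :=
  ptdf D *m (u w + uncertain_power w).

Definition inequality_constraints (u : T -> 'cV[R]_N) : Prop :=
  (forall i : 'I_N,
     chance_bounds P (beta_u D) (u_min D i 0) (u_max D i 0)
       (fun w => u w i 0)) /\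
  (forall j : 'I_Nl,
     chance_bounds P (beta_l D) (pl_min D j 0) (pl_max D j 0)
       (fun w => line_flow u w j 0)).

Definition feasibleA (x : 'cV[R]_N * 'cV[R]_N) : Prop :=
  balanced x.1 x.2 /\ inequality_constraints (policy x.1 x.2).

Definition costA (x : 'cV[R]_N * 'cV[R]_N) : R :=
  ((cost_coef D)^T *m x.1) 0 0.

Definition optimalA (x : 'cV[R]_N * 'cV[R]_N) : Prop :=
  is_unique_minimizer eq feasibleA costA x.

Definition admissible_policy (u : T -> 'cV[R]_N) : Prop :=
  exists u0 alpha, balanced u0 alpha /\ as_eq P u (policy u0 alpha).

Definition feasibleB (u : T -> 'cV[R]_N) : Prop :=
  [/\ L2_vector P u,
      admissible_policy u,
      {ae P, forall w, (ones N)^T *m (u w + uncertain_power w) = 0} &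
      inequality_constraints u].

Definition costB (u : T -> 'cV[R]_N) : \bar R :=
  'E_P[fun w => ((cost_coef D)^T *m u w) 0 0].

Definition optimalB (u : T -> 'cV[R]_N) : Prop :=
  is_unique_minimizer (as_eq P) feasibleB costB u.

End OptimalPowerFlow.

(* Main.v *)
(* With E[xi] = 0, a policy u0 - alpha 1^T S xi has expected cost h^T u0, it is
   square integrable, and its power balance holds surely as soon as its two
   coefficient equations do.  Hence (u0, alpha) |-> policy sends feasible points
   of (A) to feasible points of (B) of the same cost, and up to almost sure
   equality every feasible point of (B) is such an image.  The coefficients of an
   optimal policy are therefore optimal for (A), and uniqueness in (A) identifies
   them. *)
Require Import Defs.
From mathcomp Require Import measurable_realfun ring.
Set Implicit Arguments.
Unset Strict Implicit.
Unset Printing Implicit Defensive.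
Import Order.TTheory GRing.Theory Num.Theory.
Local Open Scope classical_set_scope.
Local Open Scope ring_scope.

(** * Univariate Gaussian laws: translation and second moment *)

(** Lebesgue measure is the only measure giving each half-open interval its length, and a
    translation preserves these lengths. *)
Lemma lebesgue_measure_shift (R : realType) (c : R) (A : set R) : measurable A ->
  pushforward lebesgue_measure (+%R c : measurableTypeR R -> measurableTypeR R) A =
  lebesgue_measure A.
Proof.
have mc : measurable_fun setT (+%R c : measurableTypeR R -> measurableTypeR R).
  by apply: measurable_funD.
move=> mA; apply/esym/lebesgue_measure_unique => //=.
move=> _ [[a b]] _ <-; rewrite /pushforward /=.
have -> : +%R c @^-1` `]a, b] = `]a - c, b - c]%classic.
  by apply/seteqP; split=> x /=; rewrite !in_itv/= ltrBlDl lerBrDl.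
rewrite !lebesgue_measure_itv/= !lte_fin ltrD2r.
by case: ifP => // _; rewrite -!EFinB; congr _%:E; ring.
Qed.

(** Change of variables x -> c + x: it pulls the density with mean c + m back to the one with mean m
    and preserves Lebesgue measure. *)
Lemma normal_prob_shift (R : realType) (m s c : R) (A : set R) :
  s != 0 -> measurable A ->
  normal_prob (c + m) s A = normal_prob m s (+%R c @^-1` A).
Proof.
move=> s0 mA; rewrite /normal_prob.
have mc : measurable_fun setT (+%R c : measurableTypeR R -> measurableTypeR R).
  by apply: measurable_funD.
have pdfE : normal_pdf m s = normal_pdf (c + m) s \o +%R c.
  apply/funext => x; rewrite /= !normal_pdfE// /normal_fun.
  by have -> : c + x - (c + m) = x - m by ring.
rewrite pdfE -[RHS](@ge0_integral_pushforward _ _ _ _ _ _ mc lebesgue_measure A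
  (EFin \o normal_pdf (c + m) s))//=.
- by apply: eq_measure_integral => B mB _; exact/esym/lebesgue_measure_shift.
- by apply/measurable_EFinP/measurable_funTS; exact: measurable_normal_pdf.
- by move=> x _; rewrite lee_fin normal_pdf_ge0.
Qed.

(** For v = 0 both sides test whether c + m lies in A; otherwise v > 0, so the standard deviation is
    nonzero. *)
Lemma gaussian_prob_shift (R : realType) (m v c : R) (A : set R) :
  0 <= v -> measurable A ->
  gaussian_prob (c + m) v A = gaussian_prob m v (+%R c @^-1` A).
Proof.
move=> v0 mA; rewrite /gaussian_prob; case: eqVneq => [_|vn0].
  by rewrite !diracE; congr (_%:R%:E); apply/idP/idP; rewrite !inE.
by rewrite normal_prob_shift// sqrtr_eq0 -ltNge lt_neqAle eq_sym vn0.
Qed.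

(** The Radon-Nikodym derivative of [normal_prob] and [normal_pdf] have the same integral over every
    measurable set, hence agree almost everywhere. *)
Lemma ge0_integral_normal_prob (R : realType) (m s : R) (f : R -> \bar R) :
  measurable_fun setT f -> (forall x, (0 <= f x)%E) ->
  (\int[normal_prob m s]_x f x =
   \int[lebesgue_measure]_x (f x * (normal_pdf m s x)%:E))%E.
Proof.
move=> mf f0.
rewrite -(Radon_Nikodym_SigmaFinite.change_of_variables
  (normal_prob_dominates m s) f0)//.
have intf := Radon_Nikodym_SigmaFinite.f_integrable (normal_prob_dominates m s).
have mpdf : measurable_fun [set: R] (EFin \o normal_pdf m s).
  by apply/measurable_EFinP; exact: measurable_normal_pdf.
apply: ae_eq_integral => //.
- by apply: emeasurable_funM => //; exact: measurable_int intf.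
- exact: emeasurable_funM.
- apply: ae_eqe_mul2l; apply: integral_ae_eq => // E _ mE.
  by rewrite -Radon_Nikodym_SigmaFinite.f_integral//; exact: normal_prob_dominates.
Qed.

Lemma normal_prob_sqr_lty (R : realType) :
  (\int[normal_prob (0 : R) 1]_x (x ^+ 2)%:E < +oo)%E.
Proof.
have m2 : measurable_fun [set: R] (fun x : R => x ^+ 2) by exact: measurable_funX.
rewrite ge0_integral_normal_prob//; last 2 first.
- exact/measurable_EFinP.
- by move=> x; rewrite lee_fin sqr_ge0.
have s2 : Num.sqrt 2 != 0 :> R by rewrite sqrtr_eq0 -ltNge.
(* x^2 exp(-x^2/2) <= 4 exp(-x^2/4) bounds the integrand by k times the density
   of N(0, 2). *)
pose k : R := 4 * normal_peak 1 / normal_peak (Num.sqrt 2).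
have kint :
    (\int[lebesgue_measure]_x (k * normal_pdf (0 : R) (Num.sqrt 2) x)%:E = k%:E)%E.
  under eq_integral do rewrite EFinM.
  rewrite integralZl//; last exact: integrable_normal_pdf.
  by rewrite integral_normal_pdf mule1.
apply: (@le_lt_trans _ _ k%:E); last exact: ltry.
rewrite -kint; apply: ge0_le_integral => //=.
- by move=> x _; rewrite lee_fin mulr_ge0 ?sqr_ge0 ?normal_pdf_ge0.
- by apply/measurable_EFinP/measurable_funM => //; exact: measurable_normal_pdf.
- by apply/measurable_EFinP/measurable_funM => //; exact: measurable_normal_pdf.
- move=> x _; rewrite lee_fin !normal_pdfE// /normal_fun subr0 expr1n sqr_sqrtr//.
  (* In terms of y the bound reads 4 y exp(-2y) <= 4 exp(-y), that is y exp(-y) <= 1, which follows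
     from 1 + y <= exp(y). *)
  set y := x ^+ 2 / 4.
  have -> : x ^+ 2 = 4 * y by rewrite /y; field.
  have -> : - (4 * y) / (1 *+ 2) = - y - y by field.
  have -> : - (4 * y) / (2 *+ 2) = - y by field.
  have -> : k * (normal_peak (Num.sqrt 2) * expR (- y)) =
            4 * normal_peak 1 * expR (- y).
    by rewrite /k mulrA divfK// gt_eqF// normal_peak_gt0.
  have yexp : y * expR (- y) <= 1.
    rewrite expRN ler_pdivrMr ?expR_gt0// mul1r.
    by apply: le_trans (expR_ge1Dx y); rewrite lerDr.
  rewrite expRD.
  have -> : 4 * y * (normal_peak 1 * (expR (- y) * expR (- y))) =
            4 * normal_peak 1 * expR (- y) * (y * expR (- y)) by ring.
  by rewrite ler_piMr// !mulr_ge0 ?expR_ge0 ?normal_peak_ge0.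
Qed.

(** * Affine images and almost sure equality of random vectors *)

Section RandomVectorLemmas.
Context {d : measure_display} {T : measurableType d} {R : realType}.
Context (P : probability T R).

(** Written as a combination of functions, the coordinate falls under the closure of [Lfun] under
    sums and scaling. *)
Lemma affine_coordE m n (b : 'cV[R]_m) (A : 'M[R]_(m, n)) (X : T -> 'cV[R]_n) i :
  (fun w => (b + A *m X w) i 0) =
  cst (b i 0) + \sum_j A i j *: (fun w => X w j 0).
Proof.
by apply/funext => w; rewrite !mxE fctE fct_sumE.
Qed.

Lemma measurable_affine m n (b : 'cV[R]_m) (A : 'M[R]_(m, n)) (X : T -> 'cV[R]_n) :
  (forall j, measurable_fun [set: T] (fun w => X w j 0)) ->
  forall i, measurable_fun [set: T] (fun w => (b + A *m X w) i 0).
Proof.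
move=> mX i; under eq_fun do rewrite !mxE.
apply: measurable_funD => //; apply: measurable_sum => j.
exact: measurable_funM.
Qed.

Lemma L2_measurable n (X : T -> 'cV[R]_n) : L2_vector P X ->
  forall i, measurable_fun [set: T] (fun w => X w i 0).
Proof. by move=> LX i; have /andP[/[!inE]] := LX i. Qed.

Lemma L2_affine m n (b : 'cV[R]_m) (A : 'M[R]_(m, n)) (X : T -> 'cV[R]_n) :
  L2_vector P X -> L2_vector P (fun w => b + A *m X w).
Proof.
move=> LX i; rewrite affine_coordE.
rewrite rpredD ?lee1n//= => [_|p1]; first exact: Lfun_cst.
by rewrite rpred_sum// => j _; exact: rpredZ.
Qed.

Lemma measurable_mulmx m n (A : 'M[R]_(m, n)) (X : T -> 'cV[R]_n) :
  (forall j, measurable_fun [set: T] (fun w => X w j 0)) ->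
  forall i, measurable_fun [set: T] (fun w => (A *m X w) i 0).
Proof.
by move=> mX i; have := measurable_affine 0 A mX i; under eq_fun do rewrite add0r.
Qed.

Lemma L2_mulmx m n (A : 'M[R]_(m, n)) (X : T -> 'cV[R]_n) :
  L2_vector P X -> L2_vector P (fun w => A *m X w).
Proof.
by move=> LX i; have := L2_affine 0 A LX i; under eq_fun do rewrite add0r.
Qed.

Lemma sqr_lty_Lfun2 (X : T -> R) : measurable_fun [set: T] X ->
  (\int[P]_w (X w ^+ 2)%:E < +oo)%E -> X \in Lfun P 2%:E.
Proof.
move=> mX X2; rewrite inE; apply/andP; split; rewrite inE//=.
rewrite /finite_norm unlock /Lnorm poweR_lty//.
under eq_integral do
  rewrite /= powR_mulrn// -normrX ger0_norm ?sqr_ge0//.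
exact: X2.
Qed.

(** Probabilities are expectations of indicators. Measurability is asked of the preimages, so that
    no sigma-algebra on column vectors enters. *)
Lemma as_eq_prob n (X Y : T -> 'cV[R]_n) (A : set 'cV[R]_n) :
  as_eq P X Y -> measurable (X @^-1` A) -> measurable (Y @^-1` A) ->
  P (X @^-1` A) = P (Y @^-1` A).
Proof.
move=> XY mX mY; rewrite -!expectation_indic// unlock.
apply: ae_eq_integral => //.
- exact/measurable_EFinP/measurable_indic.
- exact/measurable_EFinP/measurable_indic.
apply: filterS XY => w XYw _.
rewrite !indicE (_ : (w \in X @^-1` A) = (w \in Y @^-1` A))//.
by apply/idP/idP; rewrite !inE /= XYw.
Qed.

Lemma expectation_ae_eq (X Y : T -> R) :
  measurable_fun [set: T] X -> measurable_fun [set: T] Y ->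
  {ae P, forall w, X w = Y w} -> ('E_P[X] = 'E_P[Y])%E.
Proof.
move=> mX mY XY; rewrite unlock; apply: ae_eq_integral => //.
- exact/measurable_EFinP.
- exact/measurable_EFinP.
by apply: filterS XY => w -> _.
Qed.

Lemma variance_ae_eq (X Y : T -> R) :
  measurable_fun [set: T] X -> measurable_fun [set: T] Y ->
  {ae P, forall w, X w = Y w} -> ('V_P[X] = 'V_P[Y])%E.
Proof.
move=> mX mY XY; rewrite /variance unlock (expectation_ae_eq mX mY XY).
apply: expectation_ae_eq.
- by apply: measurable_funM; apply: measurable_funB.
- by apply: measurable_funM; apply: measurable_funB.
by apply: filterS XY => w XYw; rewrite fctE /= XYw.
Qed.

Lemma chance_bounds_ae_eq (beta lo hi : R) (X Y : T -> R) :
  measurable_fun [set: T] X -> measurable_fun [set: T] Y ->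
  {ae P, forall w, X w = Y w} ->
  chance_bounds P beta lo hi X -> chance_bounds P beta lo hi Y.
Proof.
move=> mX mY XY.
by rewrite /chance_bounds /mean /stddev (expectation_ae_eq mX mY XY)
  (variance_ae_eq mX mY XY).
Qed.

(** Each expectation is the integral of the identity against the image measure. *)
Lemma expectation_eq_law (X Y : T -> R) :
  X \in Lfun P 1 -> Y \in Lfun P 1 ->
  (forall A, measurable A -> P (X @^-1` A) = P (Y @^-1` A)) ->
  ('E_P[X] = 'E_P[Y])%E.
Proof.
move=> /[dup] LX /Lfun1_integrable iX /[dup] LY /Lfun1_integrable iY XY.
have mX : measurable_fun [set: T] X.
  by apply/measurable_EFinP; exact: measurable_int iX.
have mY : measurable_fun [set: T] Y.
  by apply/measurable_EFinP; exact: measurable_int iY.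
have mE : measurable_fun [set: R] (@EFin R).
  by apply/measurable_EFinP; exact: measurable_id.
rewrite unlock.
have := @integral_pushforward _ _ _ _ _ _ mX P setT (@EFin R) mE iX measurableT.
have := @integral_pushforward _ _ _ _ _ _ mY P setT (@EFin R) mE iY measurableT.
rewrite !preimage_setT => <- <-.
by apply: eq_measure_integral => A mA _; exact: XY.
Qed.

End RandomVectorLemmas.

(** * Gaussian vectors: affine images, square integrability and mean *)

Section GaussianVectors.
Context {d : measure_display} {T : measurableType d} {R : realType}.
Context (P : probability T R).

(** The projection of b + A X along t is that of X along A^T t, translated by t^T b; only a shift of
    univariate laws remains. *)
Lemma gaussian_vector_affine m n (b : 'cV[R]_m) (A : 'M[R]_(m, n))
    (X : T -> 'cV[R]_n) mu Sigma :
  gaussian_vector P X mu Sigma ->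
  gaussian_vector P (fun w => b + A *m X w) (b + A *m mu) (A *m Sigma *m A^T).
Proof.
move=> [symS posS mX lawX].
have quadE t : t^T *m (A *m Sigma *m A^T) *m t =
               (A^T *m t)^T *m Sigma *m (A^T *m t).
  by rewrite trmx_mul trmxK !mulmxA.
have linE t x : (t^T *m (b + A *m x)) 0 0 =
                (t^T *m b) 0 0 + ((A^T *m t)^T *m x) 0 0.
  by rewrite mulmxDr mxE trmx_mul trmxK mulmxA.
split.
- by rewrite !trmx_mul trmxK symS mulmxA.
- by move=> t; rewrite quadE.
- exact: measurable_affine.
move=> t B mB; rewrite quadE linE gaussian_prob_shift//.
rewrite -lawX; last first.
  rewrite -[X in measurable X]setTI.
  by have : measurable_fun [set: R] (+%R ((t^T *m b) 0 0));
    [exact: measurable_funD|exact].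
by congr (P _); apply/seteqP; split=> w /=; rewrite linE.
Qed.

(** Measurability of Y is a separate hypothesis, since the sigma-algebra of T may fail to be
    complete for P. *)
Lemma gaussian_vector_as_eq n (X Y : T -> 'cV[R]_n) mu Sigma :
  as_eq P X Y -> (forall i, measurable_fun [set: T] (fun w => Y w i 0)) ->
  gaussian_vector P X mu Sigma -> gaussian_vector P Y mu Sigma.
Proof.
move=> XY mY [symS posS mX lawX]; split=> // t A mA; rewrite -lawX//.
have m_lin (Z : T -> 'cV[R]_n) :
    (forall i, measurable_fun [set: T] (fun w => Z w i 0)) ->
    measurable (Z @^-1` [set x : 'cV[R]_n | A ((t^T *m x) 0 0)]).
  by move=> mZ; have := measurable_mulmx t^T mZ 0 measurableT mA; rewrite setTI.
exact: esym (as_eq_prob XY (m_lin X mX) (m_lin Y mY)).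
Qed.

Lemma standard_gaussian_vector_L2 n (X : T -> 'cV[R]_n) :
  gaussian_vector P X 0 1%:M -> L2_vector P X.
Proof.
move=> [_ _ mX lawX] i; apply: sqr_lty_Lfun2 => //.
have m2 : measurable_fun [set: R] (fun x : R => (x ^+ 2)%:E).
  by apply/measurable_EFinP; exact: measurable_funX.
have mXi : measurable_fun [set: T] (fun w => X w i 0 : measurableTypeR R).
  exact: mX.
rewrite -[ltLHS](@ge0_integral_pushforward _ _ _ _ _ _ mXi P setT
  (fun x : R => (x ^+ 2)%:E))//; last by move=> x _; rewrite lee_fin sqr_ge0.
rewrite (_ : integral _ _ _ = \int[normal_prob 0 1]_x (x ^+ 2)%:E)%E.
  exact: normal_prob_sqr_lty.
(* The projection along the i-th basis vector is coordinate i, with law N(0, 1). *)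
apply: eq_measure_integral => A mA _; have := lawX (delta_mx i 0) A mA.
rewrite mulmx0 mxE mulmx1 trmx_delta mul_delta_mx mxE !eqxx.
rewrite /gaussian_prob oner_eq0 sqrtr1 => lawXi; rewrite -[RHS]lawXi.
by congr (P _); apply/seteqP; split=> w /=; rewrite -rowE mxE.
Qed.

(* The reflected vector 2 mu - X has the law of X, so E[t^T X] = t^T mu needs no
   integration by parts. *)
Lemma gaussian_vector_mean n (X : T -> 'cV[R]_n) mu Sigma (t : 'cV[R]_n) :
  gaussian_vector P X mu Sigma -> L2_vector P X ->
  ('E_P[fun w => ((t^T *m X w) 0 0)%R])%E = ((t^T *m mu) 0 0)%:E.
Proof.
move=> gX LX; set m : R := (t^T *m mu) 0 0.
set Z : T -> R := fun w => (t^T *m X w) 0 0.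
have LZ : Z \in Lfun P 1.
  apply: Lfun_subset12; first exact: fin_num_measure P _ measurableT.
  exact: (L2_mulmx t^T LX 0).
have gY := gaussian_vector_affine (mu *+ 2) (- 1%:M) gX.
have reflE : (fun w => (t^T *m (mu *+ 2 + - 1%:M *m X w)) 0 0) =
             cst (m *+ 2) \- Z.
  apply/funext => w; rewrite mulNmx mul1mx mulr2n mulmxBr mulmxDr.
  by rewrite [LHS]mxE [X in X + _]mxE [X in _ + X]mxE -mulr2n.
have EZ : ('E_P[Z] = (m *+ 2)%:E - 'E_P[Z])%E.
  rewrite -(expectation_cst P) -expectationB//; last exact: Lfun_cst.
  apply: expectation_eq_law => //.
    by rewrite rpredB//; exact: Lfun_cst.
  (* Projected laws agree: 2 mu - mu = mu, and conjugation by -I fixes Sigma. *)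
  move=> A mA; rewrite -reflE.
  have [_ _ _ lawX] := gX; have [_ _ _ lawY] := gY.
  rewrite [LHS](lawX t A mA) [RHS](lawY t A mA).
  have trN1 : (- 1%:M : 'M[R]_n)^T = - 1%:M by rewrite linearN/= trmx1.
  by rewrite trN1 !mulNmx mulmxN !mul1mx mulmx1 opprK mulr2n addrK.
(* As E[Z] is finite, E[Z] = 2m - E[Z] becomes an equation between reals and gives E[Z] = m. *)
move: EZ; rewrite -(fineK (expectation_fin_num LZ)) -EFinB => -[EZ].
congr (_%:E); apply: (@mulIf _ 2) => //.
by rewrite mulr_natr mulr2n [X in X + _]EZ subrK mulr_natr.
Qed.

End GaussianVectors.

(** * Policies and the correspondence between the two problems *)

Section Policies.
Context {d : measure_display} {T : measurableType d} {R : realType}.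
Context (P : probability T R) {N Nl : nat} (D : opf_data R N Nl).
Context (xi : T -> 'cV[R]_N) (xi_germ : gaussian_vector P xi 0 1%:M).
Implicit Types (c alpha : 'cV[R]_N) (u v : T -> 'cV[R]_N).

Lemma policyE c alpha :
  policy D xi c alpha = fun w => c + (- gain D alpha) *m xi w.
Proof. by apply/funext => w; rewrite mulNmx. Qed.

Lemma policy_L2 c alpha : L2_vector P (policy D xi c alpha).
Proof. by rewrite policyE; exact/L2_affine/standard_gaussian_vector_L2. Qed.

Lemma policy_gaussian c alpha :
  gaussian_vector P (policy D xi c alpha) c
    (gain D alpha *m (gain D alpha)^T).
Proof.
have := gaussian_vector_affine c (- gain D alpha) xi_germ.
by rewrite mulmx0 addr0 mulmx1 linearN/= mulmxN mulNmx opprK policyE.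
Qed.

(** The constant terms cancel by the mean balance. The germ contributes (1 - 1^T alpha) 1^T S xi,
    which vanishes as 1^T alpha = 1. *)
Lemma policy_power_balance c alpha w : balanced D c alpha ->
  (ones N)^T *m (policy D xi c alpha w + uncertain_power D xi w) = 0.
Proof.
move=> [mean_bal /subr0_eq alpha_bal].
rewrite /policy /uncertain_power addrACA mulmxDr mean_bal add0r.
by rewrite mulmxDr mulmxN /gain !mulmxA -alpha_bal mul1mx addNr.
Qed.

(** The cost is the projection of a Gaussian vector of mean c along [cost_coef D]. *)
Lemma costB_policy c alpha :
  costB P D (policy D xi c alpha) = (costA D (c, alpha))%:E.
Proof. exact: gaussian_vector_mean (policy_gaussian c alpha) (policy_L2 _ _). Qed.

Lemma measurable_line_flow u :
  (forall i, measurable_fun [set: T] (fun w => u w i 0)) ->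
  forall j, measurable_fun [set: T] (fun w => line_flow D xi u w j 0).
Proof.
move=> mu j; have [_ _ mxi _] := xi_germ.
apply: (measurable_mulmx (ptdf D)
  (X := fun w => u w + uncertain_power D xi w)) => i.
under eq_fun do rewrite mxE.
by apply: measurable_funD => //; exact: measurable_affine.
Qed.

(** The constraints see u only through means and variances of its entries and of the line flows,
    which are pointwise functions of u. *)
Lemma inequality_constraints_as_eq u v : L2_vector P u -> L2_vector P v ->
  as_eq P u v ->
  inequality_constraints P D xi u -> inequality_constraints P D xi v.
Proof.
move=> /L2_measurable mu /L2_measurable mv uv [cu cp]; split=> i.
- by apply: chance_bounds_ae_eq (cu i) => //; apply: filterS uv => w ->.
- apply: chance_bounds_ae_eq (cp i); [exact: measurable_line_flow..|].
  by apply: filterS uv => w uvw; rewrite /line_flow uvw.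
Qed.

Lemma costB_as_eq u v : L2_vector P u -> L2_vector P v -> as_eq P u v ->
  costB P D u = costB P D v.
Proof.
move=> /L2_measurable mu /L2_measurable mv uv.
apply: expectation_ae_eq; [exact: measurable_mulmx..|].
by apply: filterS uv => w ->.
Qed.

Lemma feasibleA_policy c alpha : feasibleA P D xi (c, alpha) ->
  feasibleB P D xi (policy D xi c alpha).
Proof.
move=> [bal ineq]; split=> //.
- exact: policy_L2.
- by exists c, alpha; split=> //; apply: aeW.
- by apply: aeW => w; exact: policy_power_balance.
Qed.

Lemma feasibleB_policy u : feasibleB P D xi u ->
  exists c alpha, as_eq P u (policy D xi c alpha) /\
    feasibleA P D xi (c, alpha).
Proof.
move=> [Lu [c [alpha [bal uE]]] _ ineq]; exists c, alpha; split=> //.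
by split=> //; apply: inequality_constraints_as_eq ineq => //; exact: policy_L2.
Qed.

End Policies.

Theorem proposition1 (R : realType) (d : measure_display)
    (T : measurableType d) (P : probability T R) (N Nl : nat)
    (D : opf_data R N Nl) (xi : T -> 'cV[R]_N)
    (S_nonsingular : d_factor D \in unitmx)
    (xi_germ : gaussian_vector P xi 0 1%:M)
    (u0 alpha : 'cV[R]_N) (u : T -> 'cV[R]_N)
    (optA : optimalA P D xi (u0, alpha))
    (optB : optimalB P D xi u) :
  as_eq P u (policy D xi u0 alpha) /\
  gaussian_vector P u u0 (gain D alpha *m (gain D alpha)^T).
Proof.
have [_ uniqA] := optA; have [[feasu minu] _] := optB.
have [v0 [beta [uE feasv]]] := feasibleB_policy xi_germ feasu.
have [Lu _ _ _] := feasu.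
(* The coefficients of u minimize (A): a competitor's policy is feasible for (B), where u costs no
   more, and both costs reduce to h^T times the constant term. *)
have [v0E betaE] : (v0, beta) = (u0, alpha).
  apply: uniqA; split=> // -[y0 gamma] feasy.
  have := minu _ (feasibleA_policy xi_germ feasy).
  rewrite (costB_as_eq D Lu (policy_L2 D xi_germ v0 beta) uE).
  by rewrite (costB_policy D xi_germ v0) (costB_policy D xi_germ y0) lee_fin.
rewrite v0E betaE in uE; split; first exact: uE.
(* The policy has the claimed law exactly; almost sure equality carries it to u. *)
apply: gaussian_vector_as_eq (policy_gaussian D xi_germ u0 alpha).
  by apply: filterS uE => w /esym.
exact: L2_measurable.
Qed.
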